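(* Let $F_n$ be the free group of finite rank $n\geq 1$, and let $H$ be a finitely generated subgroup of $F_n$. Then $H$ admits a nontrivial $\cap$-complement (of any rank) if and only if $H$ has infinite index in $F_n$; that is: if $H$ admits some nontrivial $\cap$-complement then $H$ has infinite index in $F_n$, and if $H$ has infinite index in $F_n$ then $H$ admits nontrivial $\cap$-complements of any nonzero rank. Hence it is decidable, given a finite generating set of $H$, whether $H$ admits a nontrivial $\cap$-complement.
   Context: For subgroups $H,K$ of $F_n$, $K$ is a $\cap$-complement of $H$ if $H\cap K=\{1\}$; it is nontrivial if $K\neq\{1\}$. The rank of a group is the smallest cardinality of a generating set. ''Of any rank'' means of every rank attained by a subgroup of $F_n$ (i.e. every countable cardinal if $n\geq 2$, and ranks $0$ and $1$ if $n=1$). *)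

(* Defs.v *)
From HB Require Import structures.
From mathcomp Require Import all_boot.
From mathcomp Require Import boolp classical_sets functions cardinality.

Set Implicit Arguments.
Unset Strict Implicit.
Unset Printing Implicit Defensive.

Local Open Scope group_scope.
Local Open Scope classical_set_scope.
Local Open Scope card_scope.

(* The free group on n generators is realised on reduced words.               *)
(* (i, false) stands for the i-th generator and (i, true) for its inverse.    *)
Section FreeGroup.
Variable n : nat.

Definition letter : Type := 'I_n * bool.

Definition letterV (a : letter) : letter := (a.1, ~~ a.2).

Definition reduced (w : seq letter) : bool :=
  sorted (fun a b => b != letterV a) w.

Record freeGroup := FreeGroup { word :> seq letter; _ : reduced word }.

HB.instance Definition _ := [isSub for word].
HB.instance Definition _ := [Choice of freeGroup by <:].

(* The reduced form of a :: w, for a reduced word w. *)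
Definition push (a : letter) (w : seq letter) : seq letter :=
  if w is b :: w' then if b == letterV a then w' else a :: w else [:: a].

Definition wordM (u v : seq letter) : seq letter := foldr push v u.
Definition wordV (u : seq letter) : seq letter := rev (map letterV u).

Lemma letterVK : involutive letterV.
Proof. by case=> i b; rewrite /letterV /= negbK. Qed.

Lemma reduced_push a w : reduced w -> reduced (push a w).
Proof.
case: w => [|b w] //= bw; case: ifPn => [_|ba]; first exact: path_sorted bw.
by rewrite /= ba.
Qed.

Lemma reduced_wordM u v : reduced v -> reduced (wordM u v).
Proof. by move=> rv; elim: u => //= a u; apply: reduced_push. Qed.

Lemma reduced_wordV u : reduced u -> reduced (wordV u).
Proof.
rewrite /reduced /wordV rev_sorted sorted_map => ru.
apply: sub_sorted ru => a b /=; apply: contra => /eqP ->.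
by rewrite !letterVK.
Qed.

Lemma pushK a w : reduced w -> push (letterV a) (push a w) = w.
Proof.
case: w => [|b w] /=; first by rewrite letterVK eqxx.
case: ifPn => [/eqP -> {b}|_ _]; last by rewrite /= letterVK eqxx.
by case: w => [|c w] //=; rewrite letterVK => /andP[/negPf ->].
Qed.

Lemma wordM_push a u v : reduced u -> reduced v ->
  wordM (push a u) v = push a (wordM u v).
Proof.
case: u => [|b u] //= bu rv; case: ifPn => [/eqP -> |//].
by rewrite -{1}[a]letterVK pushK // reduced_wordM.
Qed.

Lemma wordMA u v w : reduced v -> reduced w ->
  wordM u (wordM v w) = wordM (wordM u v) w.
Proof.
move=> rv rw; elim: u => //= a u ->.
by rewrite wordM_push // reduced_wordM.
Qed.

Lemma wordM0 u : reduced u -> wordM u [::] = u.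
Proof.
elim: u => //= a u IHu au; rewrite IHu; last exact: path_sorted au.
by case: u au {IHu} => //= b u /andP[/negPf ->].
Qed.

Lemma wordMV u v : reduced v -> wordM (wordV u) (wordM u v) = v.
Proof.
elim: u v => //= a u IHu v rv.
rewrite /wordV /= rev_cons -cats1 /wordM foldr_cat /= -/(wordM u v).
by rewrite pushK ?reduced_wordM //; apply: IHu.
Qed.

Lemma wordVK : involutive wordV.
Proof.
move=> u; rewrite /wordV map_rev revK -map_comp map_id_in // => a _ /=.
exact: letterVK.
Qed.

Definition freeM (u v : freeGroup) : freeGroup :=
  FreeGroup (reduced_wordM u (valP v)).
Definition freeV (u : freeGroup) : freeGroup :=
  FreeGroup (reduced_wordV (valP u)).
Definition free1 : freeGroup := FreeGroup (isT : reduced [::]).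

Lemma freeMA : associative freeM.
Proof. by move=> u v w; apply: val_inj; rewrite /= wordMA // (valP v, valP w). Qed.
Lemma freeM1 : right_id free1 freeM.
Proof. by move=> u; apply: val_inj; rewrite /= wordM0 // (valP u). Qed.
Lemma free1M : left_id free1 freeM.
Proof. by move=> u; apply: val_inj. Qed.
Lemma freeVM : left_inverse free1 freeV freeM.
Proof.
move=> u; apply: val_inj => /=.
by rewrite -{2}[word u]wordM0 ?wordMV // (valP u).
Qed.
Lemma freeMV : right_inverse free1 freeV freeM.
Proof.
move=> u; rewrite -{1}[u](_ : freeV (freeV u) = u) ?freeVM //.
by apply: val_inj; apply: wordVK.
Qed.

HB.instance Definition _ :=
  isGroup.Build freeGroup freeMA free1M freeM1 freeVM freeMV.

Definition generator (i : 'I_n) : freeGroup :=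
  FreeGroup (isT : reduced [:: (i, false)]).

(* Universal property of the free group on the family [generator].            *)
Lemma freeGroup_universal (G : groupType) (f : 'I_n -> G) :
  exists2 phi : freeGroup -> G,
    {morph phi : u v / u * v} /\ (forall i, phi (generator i) = f i)
  & forall psi : freeGroup -> G, {morph psi : u v / u * v} ->
      (forall i, psi (generator i) = f i) -> psi =1 phi.
Proof.
pose fl (a : letter) : G := if a.2 then (f a.1)^-1 else f a.1.
have flV a : fl (letterV a) = (fl a)^-1.
  by case: a => i [] //=; rewrite /fl /= invgK.
pose ev (w : seq letter) : G := foldr (fun a x => fl a * x) 1 w.
have evP a w : ev (push a w) = fl a * ev w.
  case: w => [|b w] //=; case: eqP => [->|//].
  by rewrite flV mulgA mulgV mul1g.
exists (fun u => ev u).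
  split=> [u v|i]; last by rewrite /ev /= mulg1.
  rewrite /= /wordM; elim: (word u) => [|a w IHw] /=; first by rewrite mul1g.
  by rewrite evP IHw mulgA.
move=> psi psiM psif [w rw] /=.
have psi1 : psi 1 = 1 by apply: (mulgI (psi 1)); rewrite -psiM !mulg1.
have psiV u : psi u^-1 = (psi u)^-1.
  by apply: (mulgI (psi u)); rewrite -psiM !mulgV.
elim: w rw => [|[i b] w IHw] rw /=.
  by rewrite -psi1; congr psi; apply: val_inj.
have rw' : reduced w := path_sorted rw.
have rb : reduced [:: (i, b)] by [].
have -> : FreeGroup rw = FreeGroup rb * FreeGroup rw'.
  by apply: val_inj => /=; case: (w) rw => //= c w' /andP[/negPf ->].
rewrite psiM IHw; congr (_ * _).
by case: b rb {rw} => rb; rewrite /fl /= -psif -?psiV; congr psi; apply: val_inj.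
Qed.

End FreeGroup.

Section Subgroups.
Variable G : groupType.
Implicit Types (H K S : set G).

Definition subgroup H : Prop := group_closed (mem H).

Definition generated S : set G := smallest subgroup S.

Definition finitely_generated H : Prop :=
  exists2 S, finite_set S & generated S = H.

Definition left_cosets H : set (set G) :=
  [set C | exists g : G, C = [set g * h | h in H]].

Definition infinite_index H : Prop := infinite_set (left_cosets H).

(* The rank of K is the cardinal of A. *)
Definition has_rank K (T : Type) (A : set T) : Prop :=
  (exists2 S, generated S = K & S #= A) /\
  (forall S, generated S = K -> A #<= S).

Definition cap_complement H K : Prop :=
  subgroup K /\ H `&` K = [set 1].

Definition nontrivial K : Prop := K <> [set 1].

End Subgroups.

(* Partial recursive functions: [recfun k] is the type of programs for        *)
(* k-ary functions and [computes f x y] means that f halts on x with value y. *)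
Inductive recfun : nat -> Type :=
| RZero : recfun 0
| RSucc : recfun 1
| RProj k : 'I_k -> recfun k
| RComp k m : recfun m -> ('I_m -> recfun k) -> recfun k
| RPrim k : recfun k -> recfun k.+2 -> recfun k.+1
| RMin k : recfun k.+1 -> recfun k.

(* Primitive recursion is over the first argument, and the step function is   *)
(* applied to the counter, the previous value and the parameters, in that     *)
(* order; s lists the successive values.  Minimisation returns the least      *)
(* first argument with value 0, all smaller ones having a positive value.     *)
Fixpoint computes k (f : recfun k) : k.-tuple nat -> nat -> Prop :=
  match f in recfun k return k.-tuple nat -> nat -> Prop with
  | RZero => fun _ y => y = 0
  | RSucc => fun x y => y = (thead x).+1
  | RProj _ i => fun x y => y = tnth x i
  | RComp _ m g h => fun x y => exists z : m.-tuple nat,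
      (forall i, computes (h i) x (tnth z i)) /\ computes g z y
  | RPrim _ g h => fun x y => exists s : nat -> nat,
      [/\ computes g [tuple of behead x] (s 0),
          forall i, i < thead x ->
            computes h [tuple of i :: s i :: behead x] (s i.+1)
        & y = s (thead x)]
  | RMin _ g => fun x y =>
      computes g [tuple of y :: x] 0 /\
      forall i, i < y -> exists v, computes g [tuple of i :: x] v.+1
  end.

Lemma computes_fun k (f : recfun k) x y y' :
  computes f x y -> computes f x y' -> y = y'.
Proof.
elim: f x y y' => {k} [|||k m g IHg h IHh|k g IHg h IHh|k g IHg] /=.
- by move=> x y y' -> ->.
- by move=> x y y' -> ->.
- by move=> k i x y y' -> ->.
- move=> x y y' [z [hz gz]] [z' [hz' gz']].
  have zz' : z = z' by apply: eq_from_tnth => i; exact: IHh (hz i) (hz' i).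
  by rewrite zz' in gz; exact: IHg gz gz'.
- move=> x y y' [s [s0 sS ->]] [s' [s0' sS' ->]].
  have E i : i <= thead x -> s i = s' i.
    elim: i => [_|i IHi lt_i]; first exact: IHg s0 s0'.
    have := sS _ lt_i; rewrite IHi ?(ltnW lt_i) // => hi.
    exact: IHh hi (sS' _ lt_i).
  exact: E.
- move=> x y y' [y0 yP] [y0' yP'].
  case: (ltngtP y y') => // [/yP'|/yP] [v hv].
    by have := IHg _ _ _ y0 hv.
  by have := IHg _ _ _ y0' hv.
Qed.

(* A predicate P on X is decidable, relative to the coding [code] of X by     *)
(* natural numbers, if a recursive function computes its truth value.         *)
Definition recursively_decidable (X : Type) (code : X -> nat) (P : X -> Prop) :
    Prop :=
  exists f : recfun 1, forall x,
    (P x -> computes f [tuple code x] 1) /\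
    (~ P x -> computes f [tuple code x] 0).

(* Goedel numbering: letters are coded by x_i |-> 2i and x_i^-1 |-> 2i + 1,   *)
(* and sequences by the bijection CodeSeq.code from seq nat to nat.           *)
Definition code_letter n (a : letter n) : nat := a.1.*2 + a.2.
Definition code_word n (u : freeGroup n) : nat :=
  CodeSeq.code (map (@code_letter n) u).
Definition code_words n (s : seq (freeGroup n)) : nat :=
  CodeSeq.code (map (@code_word n) s).

(* Main.v *)
(* A deterministic automaton with reversible edges (a Stallings graph) can read *)
(* the reduced form of every word it can read.  If H has infinite index, only   *)
(* finitely many vertices of its Schreier graph are visited by the generators,  *)
(* so some visited vertex v has an outgoing edge c leading outside; keeping the *)
(* visited vertices only, no word starting with c is a loop at v.  With a       *)
(* letter b other than c and c^-1, the subgroup generated by the elements       *)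
(* c b^j c b^-j c^-1, j > 0, consists, apart from 1, of words starting with c,  *)
(* so a conjugate of it meets H trivially.  Its rank is bounded below by        *)
(* counting, modulo 2, the occurrences of c at each b-height.  In rank n = 1    *)
(* the same argument shows H = 1.  The converse is the pigeonhole principle on  *)
(* cosets, together with the absence of torsion.                                *)
(* Since the existence of such a finite automaton, whose size is bounded by the *)
(* number of letters of the generators, is equivalent to that of a complement,  *)
(* a bounded search decides the latter.                                         *)
Require Import Defs.
From mathcomp Require Import all_boot all_algebra zify.
From mathcomp Require Import boolp classical_sets functions cardinality.

Set Implicit Arguments.
Unset Strict Implicit.
Unset Printing Implicit Defensive.

Local Open Scope classical_set_scope.

(** In one direction ([cap_complement_infinite_index]), every element has a positive power in a
    subgroup of finite index, so a nontrivial complement would contain torsion. In the other, the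
    generators of H are read letter by letter and each time is labelled by the coset reached.
    Infinite index means that the finitely many visited cosets are not closed under all letters, so
    some edge is missing ([infinite_index_labelling]). Conversely, any labelling with the same
    formal properties, whatever its origin, yields an inverse automaton whose loops at 0 contain H
    ([labelling_automaton]). If x leads to a vertex without edge c, no word of x^-1 H x starts with
    c, while all nontrivial words of a comb do; this gives complements of every attained nonzero
    rank ([automaton_complement]), the rank being bounded below by linear algebra over F_2
    ([comb_rank_ge]). Labelling, infinite index and complement are thus equivalent. A labelling is a
    finite object of bounded size, so a bounded search decides its existence ([labelling_codeP],
    [recursive_labelled_code]). *)

(** * Recursive functions *)

(* Arguments are read off a list (missing ones being 0), so that the variables *)
(* of an expression behave as de Bruijn indices.                               *)
Definition recursive (F : seq nat -> nat) : Prop :=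
  forall k, exists f : recfun k, forall x : k.-tuple nat, computes f x (F x).

(** The length of [S x] depends on [x] only through its length, so that composing with [S] needs a
    program of one fixed arity. *)
Definition recursive_seq (S : seq nat -> seq nat) : Prop :=
  (forall k, exists m, forall x, size x = k -> size (S x) = m) /\
  forall i, recursive (fun x => nth 0 (S x) i).

Definition recursiveb (P : seq nat -> bool) : Prop :=
  recursive (fun x => P x : nat).

Section Recursive.
Implicit Types (F G N : seq nat -> nat) (S : seq nat -> seq nat).
Implicit Types (P Q : seq nat -> bool).

Lemma eq_recursive F G : F =1 G -> recursive F -> recursive G.
Proof. by move=> FG rF k; have [f fP] := rF k; exists f => x; rewrite -FG. Qed.

Lemma recursive0 : recursive (fun=> 0).
Proof.
move=> k; have h : 'I_0 -> recfun k by case.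
exists (RComp RZero h) => x.
by exists [tuple]; split=> // -[].
Qed.

Lemma recursive_nth i : recursive (fun x => nth 0 x i).
Proof.
move=> k; have [ik|ki] := ltnP i k.
  by exists (RProj (Ordinal ik)) => x; rewrite /= (tnth_nth 0).
have [f fP] := recursive0 k; exists f => x.
by rewrite nth_default ?size_tuple.
Qed.

Lemma recursive_comp G S :
  recursive G -> recursive_seq S -> recursive (fun x => G (S x)).
Proof.
move=> rG [szS rS] k; have [m szSm] := szS k; have [g gP] := rG m.
have [h hP] := choice (fun i : 'I_m => rS i k).
exists (RComp g h) => x.
have szSx : size (S x) == m by apply/eqP/szSm; rewrite size_tuple.
exists (Tuple szSx); split=> [i|]; last exact: gP (Tuple szSx).
by rewrite (tnth_nth 0); apply: hP.
Qed.

Lemma recursive_seq_id : recursive_seq id.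
Proof. by split=> [k|i]; [exists k | apply: recursive_nth]. Qed.

Lemma recursive_seq_drop j S : recursive_seq S -> recursive_seq (fun x => drop j (S x)).
Proof.
move=> [szS rS]; split=> [k|i].
  by have [m szSm] := szS k; exists (m - j) => x /szSm; rewrite size_drop => ->.
by apply: eq_recursive (rS (j + i)) => x; rewrite nth_drop.
Qed.

Lemma recursive_seq_cons F S :
  recursive F -> recursive_seq S -> recursive_seq (fun x => F x :: S x).
Proof.
move=> rF [szS rS]; split=> [k|[|i] //].
by have [m szSm] := szS k; exists m.+1 => x /szSm /= ->.
exact: rS.
Qed.

Lemma recursive_seq_nil : recursive_seq (fun=> [::]).
Proof.
split=> [k|i]; first by exists 0.
by apply: eq_recursive recursive0 => x; rewrite nth_nil.
Qed.

Lemma recursive_nth_seq i S : recursive_seq S -> recursive (fun x => nth 0 (S x) i).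
Proof. by case. Qed.

(* In the step function, the counter is argument 0 and the previous value is  *)
(* argument 1; the other ones are shifted by 2.                               *)
Lemma recursive_rec G (H : seq nat -> nat -> nat -> nat) N : recursive N ->
  recursive G -> recursive (fun y => H (drop 2 y) (nth 0 y 0) (nth 0 y 1)) ->
  recursive (fun x => nat_rect (fun=> nat) (G x) (H x) (N x)).
Proof.
move=> rN rG rH.
pose R y := nat_rect (fun=> nat) (G (drop 1 y)) (H (drop 1 y)) (nth 0 y 0).
have rR : recursive R.
  (* [RPrim] only builds positive arities; in arity 0 the absent counter reads as 0 and the value is
     the initial one. *)
  case=> [|k].
    by have [g gP] := rG 0; exists g => x; rewrite tuple0; apply: (gP [tuple]).
  have [g gP] := rG k; have [h hP] := rH k.+2.
  exists (RPrim g h) => x; case/tupleP: x => m x.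
  exists (nat_rect (fun=> nat) (G x) (H x)); split=> /=.
  - by have := gP x; congr (computes g _ _); apply: val_inj.
  - move=> i _; set v := nat_rect _ _ _ _.
    have := hP [tuple of i :: v :: x]; rewrite /= drop0.
    by congr (computes h _ _); apply: val_inj.
  - by rewrite /R /= drop0 theadE.
have : recursive (fun x => R (N x :: x)).
  by apply: recursive_comp rR (recursive_seq_cons rN recursive_seq_id).
by apply: eq_recursive => x; rewrite /R /= drop0.
Qed.

Lemma recursiveS F : recursive F -> recursive (fun x => (F x).+1).
Proof.
move=> rF; have r1 : recursive (fun x => (nth 0 x 0).+1).
  move=> k; have [f fP] := recursive_nth 0 k.
  exists (RComp RSucc (fun _ : 'I_1 => f)) => x; exists [tuple nth 0 x 0]; split=> //.
  by move=> i; rewrite (ord1 i); apply: fP.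
apply: recursive_comp r1 (recursive_seq_cons rF recursive_seq_nil).
Qed.

Lemma recursive_const c : recursive (fun=> c).
Proof. by elim: c => [|c]; [apply: recursive0 | apply: recursiveS]. Qed.

End Recursive.

Ltac rec_step :=
  first
  [ assumption
  | apply: recursive_seq_drop | apply: recursive_seq_id
  | apply: recursive_const
  | apply: recursive_nth_seq
  | match goal with
    | hF : recursive ?F |- recursive (fun y => ?F _) =>
      apply: (recursive_comp hF)
    | hF : recursiveb ?F |- recursive (fun y => nat_of_bool (?F _)) =>
      apply: (recursive_comp hF)
    | hF : recursiveb ?F |- recursiveb (fun y => ?F _) =>
      apply: (recursive_comp hF)
    end
  | apply: recursiveS ].

(** * Arithmetic, Boolean connectives and bounded quantifiers *)

Section Arith.
Implicit Types (F G N : seq nat -> nat) (S : seq nat -> seq nat).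
Implicit Types (P Q : seq nat -> bool).

Lemma recursiveD F G : recursive F -> recursive G -> recursive (fun x => F x + G x).
Proof.
move=> rF rG.
apply: (@eq_recursive (fun x => nat_rect (fun=> nat) (G x) (fun _ v => v.+1) (F x))).
  by move=> x; elim: (F x) => //= i ->.
by apply: recursive_rec => //; repeat rec_step.
Qed.

Lemma recursive_pred F : recursive F -> recursive (fun x => (F x).-1).
Proof.
move=> rF.
apply: (@eq_recursive (fun x => nat_rect (fun=> nat) 0 (fun i _ => i) (F x))).
  by move=> x; case: (F x).
by apply: recursive_rec => //; repeat rec_step.
Qed.

Lemma recursiveB F G : recursive F -> recursive G -> recursive (fun x => F x - G x).
Proof.
move=> rF rG.
apply: (@eq_recursive (fun x => nat_rect (fun=> nat) (F x) (fun _ v => v.-1) (G x))).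
  by move=> x; elim: (G x) => [|i /= ->]; rewrite ?subn0 // subnS.
by apply: recursive_rec => //; apply: recursive_pred; repeat rec_step.
Qed.

Lemma recursiveM F G : recursive F -> recursive G -> recursive (fun x => F x * G x).
Proof.
move=> rF rG.
apply: (@eq_recursive (fun x => nat_rect (fun=> nat) 0 (fun _ v => G x + v) (F x))).
  by move=> x; elim: (F x) => //= i ->; rewrite mulSn.
by apply: recursive_rec => //; try apply: recursiveD; repeat rec_step.
Qed.

Lemma recursiveX F G : recursive F -> recursive G -> recursive (fun x => F x ^ G x).
Proof.
move=> rF rG.
apply: (@eq_recursive (fun x => nat_rect (fun=> nat) 1 (fun _ v => F x * v) (G x))).
  by move=> x; elim: (G x) => //= i ->; rewrite expnS.
by apply: recursive_rec => //; try apply: recursiveM; repeat rec_step.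
Qed.

Lemma recursive_eq0 F : recursive F -> recursiveb (fun x => F x == 0).
Proof.
move=> rF; apply: (@eq_recursive (fun x => 1 - F x)); first by move=> x; case: (F x).
by apply: recursiveB => //; apply: recursive_const.
Qed.

Lemma recursive_not P : recursiveb P -> recursiveb (fun x => ~~ P x).
Proof. by move=> /recursive_eq0; apply: eq_recursive => x; case: (P x). Qed.

Lemma recursive_and P Q : recursiveb P -> recursiveb Q -> recursiveb (fun x => P x && Q x).
Proof.
by move=> rP rQ; apply: eq_recursive (recursiveM rP rQ) => x; rewrite mulnb.
Qed.

Lemma recursive_or P Q : recursiveb P -> recursiveb Q -> recursiveb (fun x => P x || Q x).
Proof.
move=> /recursive_not rP /recursive_not rQ.
by apply: eq_recursive (recursive_not (recursive_and rP rQ)) => x; rewrite negb_and !negbK.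
Qed.

Lemma recursive_imply P Q : recursiveb P -> recursiveb Q -> recursiveb (fun x => P x ==> Q x).
Proof.
move=> /recursive_not rP rQ.
by apply: eq_recursive (recursive_or rP rQ) => x; rewrite implybE.
Qed.

Lemma recursive_leq F G : recursive F -> recursive G -> recursiveb (fun x => F x <= G x).
Proof. by move=> rF rG; apply: (@recursive_eq0 (fun x => F x - G x)); apply: recursiveB. Qed.

Lemma recursive_eqn F G : recursive F -> recursive G -> recursiveb (fun x => F x == G x).
Proof.
move=> rF rG; apply: (@eq_recursive (fun x => (F x <= G x) && (G x <= F x))).
  by move=> x; rewrite -eqn_leq.
exact: (recursive_and (recursive_leq rF rG) (recursive_leq rG rF)).
Qed.

Lemma recursive_if P F G : recursiveb P -> recursive F -> recursive G ->
  recursive (fun x => if P x then F x else G x).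
Proof.
move=> rP rF rG; apply: (@eq_recursive (fun x => P x * F x + ~~ P x * G x)).
  by move=> x; case: (P x); rewrite ?mul1n ?mul0n ?addn0.
by apply: recursiveD; apply: recursiveM => //; apply: recursive_not.
Qed.

Lemma recursive_all (P : seq nat -> nat -> bool) N : recursive N ->
  recursiveb (fun y => P (drop 2 y) (nth 0 y 0)) ->
  recursiveb (fun x => all (P x) (iota 0 (N x))).
Proof.
move=> rN rP.
apply: (@eq_recursive (fun x => nat_rect (fun=> nat) 1 (fun i v => P x i * v) (N x))).
  move=> x; elim: (N x) => // i IHi; rewrite [LHS]/= IHi.
  by rewrite -[in RHS]addn1 iotaD all_cat /= andbT mulnb andbC.
by apply: recursive_rec => //; try apply: recursiveM; repeat rec_step.
Qed.

Lemma recursive_has (P : seq nat -> nat -> bool) N : recursive N ->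
  recursiveb (fun y => P (drop 2 y) (nth 0 y 0)) ->
  recursiveb (fun x => has (P x) (iota 0 (N x))).
Proof.
move=> rN /recursive_not rP.
apply: eq_recursive (recursive_not (@recursive_all (fun x i => ~~ P x i) _ rN rP)) => x.
by congr nat_of_bool; elim: (iota _ _) => //= i t <-; rewrite negb_and negbK.
Qed.

Lemma recursive_sum (P : seq nat -> nat -> bool) N : recursive N ->
  recursiveb (fun y => P (drop 2 y) (nth 0 y 0)) ->
  recursive (fun x => count (P x) (iota 0 (N x))).
Proof.
move=> rN rP.
apply: (@eq_recursive (fun x => nat_rect (fun=> nat) 0 (fun i v => P x i + v) (N x))).
  move=> x; elim: (N x) => // i IHi; rewrite [LHS]/= IHi.
  by rewrite -[in RHS]addn1 iotaD count_cat /= addn0 addnC.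
by apply: recursive_rec => //; try apply: recursiveD; repeat rec_step.
Qed.

End Arith.

Ltac rec_tac :=
  repeat first
  [ assumption
  | match goal with
    | |- recursive (fun x => nat_of_bool (@?P x)) => change (recursiveb P)
    | |- recursiveb (fun x => @?F x <= @?G x) => apply: (@recursive_leq F G)
    | |- recursiveb (fun x => @?F x == @?G x) => apply: (@recursive_eqn F G)
    | |- recursiveb (fun x => ~~ (@?P x)) => apply: (@recursive_not P)
    | |- recursiveb (fun x => @?P x && @?Q x) => apply: (@recursive_and P Q)
    | |- recursiveb (fun x => @?P x || @?Q x) => apply: (@recursive_or P Q)
    | |- recursiveb (fun x => @?P x ==> @?Q x) => apply: (@recursive_imply P Q)
    | |- recursiveb (fun x => all (@?P x) (iota 0 (@?N x))) => apply: (@recursive_all P N)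
    | |- recursiveb (fun x => has (@?P x) (iota 0 (@?N x))) => apply: (@recursive_has P N)
    | |- recursive (fun x => count (@?P x) (iota 0 (@?N x))) => apply: (@recursive_sum P N)
    | |- recursive (fun x => @?F x + @?G x) => apply: (@recursiveD F G)
    | |- recursive (fun x => @?F x - @?G x) => apply: (@recursiveB F G)
    | |- recursive (fun x => @?F x * @?G x) => apply: (@recursiveM F G)
    | |- recursive (fun x => @?F x ^ @?G x) => apply: (@recursiveX F G)
    end
  | rec_step ].

(** Quotients and 2-adic valuations are obtained below by bounded counting, which avoids
    minimisation; this evaluates the counts. *)
Lemma count_ltn_iota m k : k <= m -> count (fun i => i < k) (iota 0 m) = k.
Proof.
move=> km; rewrite -(subnKC km) iotaD count_cat add0n.
rewrite (eq_in_count (a2 := predT)) ?count_predT ?size_iota; last first.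
  by move=> i; rewrite mem_iota.
rewrite (eq_in_count (a2 := pred0)) ?count_pred0 ?addn0 // => i.
by rewrite mem_iota => /andP[ki _]; rewrite ltnNge ki.
Qed.

Lemma recursive_iter (f : nat -> nat) F N :
  (forall G, recursive G -> recursive (fun x => f (G x))) ->
  recursive N -> recursive F -> recursive (fun x => iter (N x) f (F x)).
Proof.
move=> rf rN rF.
apply: (@eq_recursive (fun x => nat_rect (fun=> nat) (F x) (fun _ v => f v) (N x))).
  by move=> x; elim: (N x) => //= i ->.
by apply: recursive_rec => //; apply: rf; rec_tac.
Qed.

Lemma recursive_divn F G : recursive F -> recursive G -> recursive (fun x => F x %/ G x).
Proof.
move=> rF rG; apply: (@eq_recursive (fun x =>
    count (fun q => (0 < G x) && (q.+1 * G x <= F x)) (iota 0 (F x)))); last by rec_tac.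
move=> x; have [->|G0] := posnP (G x).
  by rewrite divn0; elim: (iota _ _).
rewrite -[RHS](count_ltn_iota (leq_div (F x) (G x))).
by apply: eq_count => q /=; rewrite leq_divRL.
Qed.

Lemma recursive_modn F G : recursive F -> recursive G -> recursive (fun x => F x %% G x).
Proof.
move=> rF rG; apply: (@eq_recursive (fun x => F x - F x %/ G x * G x)).
  by move=> x; rewrite {1}(divn_eq (F x) (G x)) addKn.
by rec_tac; apply: recursive_divn.
Qed.

(** * Coded lists, digits and the bounded search *)

(* [code_head] and [code_tail] split the code 2 ^ i * (2 c + 1) into i and c; *)
(* both give 0 on the code 0 of the empty list.                               *)
Definition code_head c := count (fun i => c %% 2 ^ i.+1 == 0) (iota 0 c).
Definition code_tail c := c %/ 2 ^ (code_head c).+1.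
Definition code_cons i c := 2 ^ i * (2 * c).+1.

Lemma code_consE i s : CodeSeq.code (i :: s) = code_cons i (CodeSeq.code s).
Proof. by rewrite /code_cons mul2n. Qed.

(** 2^(j+1) divides 2^i (2 c + 1) exactly when j < i, and the bound of the count is at least i, so
    every such j is counted. *)
Lemma code_headE i s : code_head (CodeSeq.code (i :: s)) = i.
Proof.
rewrite code_consE /code_head; set c := CodeSeq.code s.
have lt_i : i <= code_cons i c.
  by rewrite (leq_trans (ltnW (ltn_expl i (ltnSn 1)))) // leq_pmulr.
rewrite -[RHS](count_ltn_iota lt_i); apply: eq_count => j /=.
have [ji|ij] := ltnP j i.
  by rewrite -(subnKC ji) /code_cons expnD -mulnA modnMr.
have -> : 2 ^ j.+1 = 2 ^ i * (2 * 2 ^ (j - i)).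
  by rewrite -expnS -expnD; congr (2 ^ _); lia.
rewrite /code_cons -/(dvdn _ _) dvdn_pmul2l ?expn_gt0 //.
by apply/negP => /(dvdn_trans (dvdn_mulr _ (dvdnn 2))); rewrite dvdn2 /= mul2n odd_double.
Qed.

Lemma code_tailE i s : code_tail (CodeSeq.code (i :: s)) = CodeSeq.code s.
Proof.
rewrite /code_tail code_headE code_consE /code_cons expnSr divnMl ?expn_gt0 //.
by rewrite -addn1 mulnC divnMDl // divn_small ?addn0.
Qed.

Lemma recursive_code_head F : recursive F -> recursive (fun x => code_head (F x)).
Proof. by move=> rF; rewrite /code_head; rec_tac; apply: recursive_modn; rec_tac. Qed.

Lemma recursive_code_tail F : recursive F -> recursive (fun x => code_tail (F x)).
Proof.
by move=> rF; apply: recursive_divn => //; rec_tac; apply: recursive_code_head.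
Qed.

Lemma recursive_code_cons F G :
  recursive F -> recursive G -> recursive (fun x => code_cons (F x) (G x)).
Proof. by move=> rF rG; rewrite /code_cons; rec_tac. Qed.

(** Counterpart of [read_step] on codes: a head equal to 0 codes an exhausted first word. The code 0
    of the empty list is fixed. *)
Definition code_step c :=
  if code_head c == 0 then code_tail c
  else code_cons (code_tail (code_head c)) (code_tail c).

Definition code_read c t := iter t code_step c.

Lemma recursive_code_read F G :
  recursive F -> recursive G -> recursive (fun x => code_read (F x) (G x)).
Proof.
move=> rF rG; apply: recursive_iter => // N rN; rewrite /code_step; apply: recursive_if; rec_tac;
  do ?[apply: recursive_code_cons|apply: recursive_code_head|apply: recursive_code_tail];
  by [].
Qed.

Definition digit M c t := c %/ M ^ t %% M.

Lemma recursive_digit F G N : recursive F -> recursive G -> recursive N ->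
  recursive (fun x => digit (F x) (G x) (N x)).
Proof.
move=> rF rG rN; apply: recursive_modn => //; apply: recursive_divn => //.
exact: recursiveX.
Qed.

(** Packs a bounded finite sequence of labels into one number below an explicit bound, by Horner's
    scheme. *)
Lemma digits_ex M (d : nat -> nat) m : (forall t, t < m -> d t < M) ->
  exists2 c, c < M ^ m & forall t, t < m -> digit M c t = d t.
Proof.
elim: m d => [|m IHm] d dM; first by exists 0.
have [c cM cd] := IHm (d \o succn) (fun t => dM t.+1).
have M0 : 0 < M := leq_ltn_trans (leq0n _) (dM 0 (ltn0Sn m)).
exists (c * M + d 0).
  rewrite expnSr; apply: (@leq_trans (c.+1 * M)); last by rewrite leq_mul2r cM orbT.
  by rewrite mulSn addnC ltn_add2r dM.
case=> [_|t tm]; rewrite /digit.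
  by rewrite expn0 divn1 modnMDl modn_small // dM.
by rewrite expnS divnMA divnMDl // (divn_small (dM 0 _)) // addn0; apply: cd.
Qed.

(** A generator and its inverse are coded by 2i and 2i + 1, and this exchanges the two. *)
Definition inv_code x := x.+1 - 2 * (x %% 2).

(* The conditions of [labelling], for the word list with code N and the       *)
(* labels given by the base M digits of c.                                    *)
Definition arc_code N M c p x q :=
  has (fun t => [&& ~~ (code_head (code_read N t) == 0),
                    code_head (code_head (code_read N t)) == x,
                    digit M c t == p & digit M c t.+1 == q])
      (iota 0 N.+1).

Definition edge_code N M c p x q :=
  arc_code N M c p x q || arc_code N M c q (inv_code x) p.

Definition end_code N M c :=
  all (fun t => (code_head (code_read N t) == 0) ==>
                ((digit M c t == 0) && (digit M c t.+1 == 0))) (iota 0 N.+1).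

Definition det_code k N M c :=
  all (fun p => all (fun x => all (fun q => all (fun q' =>
    (edge_code N M c p x q && edge_code N M c p x q') ==> (q == q'))
  (iota 0 M)) (iota 0 M)) (iota 0 k)) (iota 0 M).

Definition missing_code k N M c :=
  has (fun t => has (fun x => all (fun q => ~~ edge_code N M c (digit M c t) x q)
  (iota 0 M)) (iota 0 k)) (iota 0 N.+2).

Definition labelling_code k N M c :=
  [&& digit M c 0 == 0, end_code N M c, det_code k N M c & missing_code k N M c].

(** Labels are needed at the times 0, ..., N + 1 and can be chosen with [d t <= t]; hence N + 2
    digits in base N + 2. *)
Definition labelled_code k N := has (labelling_code k N N.+2) (iota 0 (N.+2 ^ N.+2)).

Ltac rec_code :=
  repeat first
  [ match goal with
    | |- recursive (fun x => code_head (@?F x)) => apply: (@recursive_code_head F)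
    | |- recursive (fun x => code_read (@?F x) (@?G x)) =>
      apply: (@recursive_code_read F G)
    | |- recursive (fun x => digit (@?F x) (@?G x) (@?H x)) =>
      apply: (@recursive_digit F G H)
    | |- recursive (fun x => @?F x %% @?G x) => apply: (@recursive_modn F G)
    end
  | progress rec_tac ].

Section RecursiveEdge.
Variables (N M c p x q : seq nat -> nat).
Hypotheses (rN : recursive N) (rM : recursive M) (rc : recursive c).

Lemma recursive_edge_code : recursive p -> recursive x -> recursive q ->
  recursiveb (fun y => edge_code (N y) (M y) (c y) (p y) (x y) (q y)).
Proof.
by move=> rp rx rq; rewrite /edge_code /arc_code /inv_code; rec_code.
Qed.

Lemma recursive_end_code : recursiveb (fun y => end_code (N y) (M y) (c y)).
Proof. by rewrite /end_code; rec_code. Qed.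

End RecursiveEdge.

Section RecursiveLabelling.
Variables (k : nat) (N M c : seq nat -> nat).
Hypotheses (rN : recursive N) (rM : recursive M) (rc : recursive c).

Ltac rec_edge :=
  do ?[progress rec_code | apply: recursive_edge_code].

Lemma recursive_labelling_code :
  recursiveb (fun y => labelling_code k (N y) (M y) (c y)).
Proof.
rewrite /labelling_code /det_code /missing_code.
rec_edge; by apply: recursive_end_code.
Qed.

End RecursiveLabelling.

Lemma recursive_labelled_code k : recursiveb (fun y => labelled_code k (nth 0 y 0)).
Proof.
rewrite /labelled_code.
have r0 : recursive (fun y => nth 0 y 0) by exact: recursive_nth.
apply: (@recursive_has (fun y => labelling_code k (nth 0 y 0) (nth 0 y 0).+2)).
  by rec_code.
by apply: recursive_labelling_code; rec_code.
Qed.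

Local Open Scope group_scope.
Local Open Scope card_scope.

(** * Subgroups and cosets *)

Section Subgroups.
Variable G : groupType.
Implicit Types (H K S : set G) (x y g : G).

Lemma subgroupP H :
  subgroup H <-> H 1 /\ (forall x y, H x -> H y -> H (x * y^-1)).
Proof.
split=> [[/set_mem H1 HB]|[H1 HB]]; split=> //.
- by move=> x y /mem_set Hx /mem_set Hy; apply/set_mem/HB.
- exact: mem_set.
- by move=> x y /set_mem Hx /set_mem Hy; apply/mem_set/HB.
Qed.

Lemma subgroup1 H : subgroup H -> H 1.
Proof. by case/subgroupP. Qed.

Lemma subgroupV H x : subgroup H -> H x -> H x^-1.
Proof. by case/subgroupP=> H1 HB Hx; rewrite -[x^-1]mul1g; apply: HB. Qed.

Lemma subgroupM H x y : subgroup H -> H x -> H y -> H (x * y).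
Proof.
move=> sH Hx Hy; rewrite -[y]invgK.
by case/subgroupP: (sH) => _; apply=> //; apply: subgroupV.
Qed.

Lemma subgroupX H x m : subgroup H -> H x -> H (x ^+ m).
Proof.
move=> sH Hx; elim: m => [|m IHm]; first exact: subgroup1.
by rewrite expgS; apply: subgroupM.
Qed.

Lemma generated_subgroup S : subgroup (generated S).
Proof.
apply/subgroupP; split=> [|x y Sx Sy] M /= [sM SM]; first exact: subgroup1.
apply: (subgroupM sM); first exact: Sx.
by apply: (subgroupV sM); apply: Sy.
Qed.

Lemma sub_generated S : S `<=` generated S.
Proof. exact: sub_gen_smallest. Qed.

Lemma generated_sub S H : subgroup H -> S `<=` H -> generated S `<=` H.
Proof. exact: smallest_sub. Qed.

Lemma subgroup_conj H g : subgroup H -> subgroup [set x | H (x ^ g)].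
Proof.
move=> sH; apply/subgroupP; split=> [|x y /= Hx Hy].
  by rewrite /= conj1g; apply: subgroup1.
by rewrite conjMg conjVg; apply: subgroupM => //; apply: subgroupV.
Qed.

Lemma generated_nonempty S x : generated S x -> x <> 1 -> S !=set0.
Proof.
move=> Sx x1; apply/set0P/eqP => S0; apply: x1; move: x Sx.
apply: (@generated_sub _ [set 1]); last by rewrite S0.
by apply/subgroupP; split=> // _ _ -> ->; rewrite /= mulgV.
Qed.

Lemma has_rank_cycle (T : Type) (t : T) x :
  x <> 1 -> has_rank (generated [set x]) [set t].
Proof.
move=> x1; split=> [|S gS]; first by exists [set x] => //; apply: eq_card1.
have [y Sy] : S !=set0 by apply: generated_nonempty x1; rewrite gS; apply: sub_generated.
by rewrite (card_le_eql (eq_card1 _ y)); apply: subset_card_le => _ ->.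
Qed.

Definition left_coset H g : set G := [set g * h | h in H].

Lemma left_coset_eq H g g' : subgroup H ->
  left_coset H g = left_coset H g' <-> H (g^-1 * g').
Proof.
move=> sH; split=> [eqgg'|Hgg'].
  have : left_coset H g g' by rewrite eqgg'; exists 1; rewrite ?mulg1 //; exact: subgroup1.
  by case=> h Hh <-; rewrite mulKg.
apply/seteqP; split=> _ [h Hh <-].
  exists (g'^-1 * g * h); last by rewrite !mulgA mulgV mul1g.
  by apply: subgroupM => //; rewrite -[_ * g]invgK invgM invgK; apply: subgroupV.
by exists (g^-1 * g' * h); [apply: subgroupM | rewrite !mulgA mulgV mul1g].
Qed.

(* Pigeonhole on the cosets [x ^+ i * H]. *)
Lemma finite_index_power H x : subgroup H -> ~ infinite_index H ->
  exists2 m, (0 < m)%N & H (x ^+ m).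
Proof.
move=> sH /contrapT fH.
have [i [j [ltij eqij]]] : exists i j, (i < j)%N /\
    left_coset H (x ^+ i) = left_coset H (x ^+ j).
  apply: contrapT => inj; apply: infinite_nat.
  apply: card_le_finite fH.
  apply: card_le_trans (subset_card_le (_ : [set left_coset H (x ^+ i) | i in setT] `<=` _)).
    rewrite (card_le_eqr (inj_card_eq _)) ?card_lexx //.
    move=> i j _ _ eij; case: (ltngtP i j) => // lt; exfalso; apply: inj.
      by exists i, j.
    by exists j, i.
  by move=> _ [i _ <-]; exists (x ^+ i).
exists (j - i)%N; first by rewrite subn_gt0.
move/(left_coset_eq _ _ sH): eqij.
by rewrite -{1}(subnKC (ltnW ltij)) expgnDr mulKg.
Qed.

End Subgroups.

(** * Free groups and inverse automata *)

Section FreeGroupWords.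
Variable n : nat.
Implicit Types (a b : letter n) (u v w : seq (letter n)) (x y g : freeGroup n).

Definition letter_elt a : freeGroup n := FreeGroup (isT : reduced [:: a]).

Lemma letterV_neq a : letterV a != a.
Proof. by case: a => i []; apply/eqP. Qed.

Lemma letterV_eq a b : (letterV a == b) = (a == letterV b).
Proof. by rewrite -(inj_eq (can_inj (@letterVK n))) letterVK. Qed.

Lemma letter_eltV a : (letter_elt a)^-1 = letter_elt (letterV a).
Proof. exact: val_inj. Qed.

Lemma wordM_cat u v : reduced (u ++ v) -> wordM u v = u ++ v.
Proof.
move=> ruv; have rv : reduced v.
  by case: u ruv => //= a u; rewrite cat_path => /andP[_ /path_sorted].
by rewrite -[RHS](wordM0 ruv) /wordM foldr_cat -/(wordM v [::]) wordM0.
Qed.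

Lemma word1 x : word x = [::] -> x = 1.
Proof. by move=> x0; apply: val_inj. Qed.

Lemma word_cons x a w : word x = a :: w ->
  exists2 y, x = letter_elt a * y & word y = w.
Proof.
move=> xE; have rx : reduced (a :: w) by rewrite -xE; apply: valP.
exists (FreeGroup (path_sorted rx : reduced w)) => //; apply: val_inj.
by rewrite /= xE; case: (w) rx => //= b w' /andP[/negPf ->].
Qed.

Lemma free_ind (P : freeGroup n -> Prop) :
  P 1 -> (forall a x, P x -> P (letter_elt a * x)) -> forall x, P x.
Proof.
move=> P1 PM x; elim: {x}(word x) {-2}x (erefl (word x)) => [|a w IHw] x xE.
  by rewrite (word1 xE).
by have [y -> /IHw] := word_cons xE; apply: PM.
Qed.

(* A word whose last letter does not cancel its first one stays cyclically    *)
(* reduced in all its powers; any other word is conjugate to a shorter one.   *)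
Lemma free_torsion_free x m : x ^+ m.+1 = 1 -> x = 1.
Proof.
have [k] := ubnP (size (word x)); elim: k x => // k IHk x.
case xE: (word x) => [|a w] szx; first by move=> _; apply: word1.
have rx : reduced (a :: w) by rewrite -xE; apply: valP.
have [aE|aNE] := eqVneq a (letterV (last a w)); last first.
  have [t tE] : exists t, word (x ^+ m.+1) = a :: t.
    elim: (m) => [|i [t tE]]; first by exists w; rewrite expg1.
    exists (w ++ a :: t); rewrite expgS /= xE tE wordM_cat //=.
    have : reduced (a :: t) by rewrite -tE; apply: valP.
    by rewrite /= cat_path => rt; apply/and3P; split.
  by move=> x1; rewrite x1 in tE.
case/lastP: w => [|w b] in xE szx rx aE.
  by move: (letterV_neq a); rewrite -aE eqxx.
rewrite last_rcons in aE; have bE : b = letterV a by rewrite aE letterVK.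
have rw : reduced w.
  by move: rx; rewrite /= -cats1 cat_path => /andP[/path_sorted].
pose y := FreeGroup rw.
have -> : x = y ^ (letter_elt a)^-1.
  apply: val_inj; rewrite conjgE invgK letter_eltV -bE.
  rewrite [LHS](xE : val x = _) /= -cats1.
  rewrite wordM_cat; last by move: rx; rewrite -cats1 /= => /path_sorted.
  rewrite cats1; case: (rcons w b) rx => //= c s.
  by case/andP=> /negPf ->.
rewrite -conjXg => /eqP; rewrite conjg_eq1 => /eqP /(IHk y) -> //.
  by rewrite conj1g.
by move: szx; rewrite /= size_rcons ltnS; apply: leq_trans.
Qed.

(** If the index were finite, some positive power of each x in K would lie in H and in K, hence be
    1, and x = 1 for lack of torsion. *)
Theorem cap_complement_infinite_index (H K : set (freeGroup n)) :
  subgroup H -> cap_complement H K -> nontrivial K -> infinite_index H.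
Proof.
move=> sH [sK HK1] nK; apply: contrapT => fH; apply: nK.
apply/seteqP; split=> [x Kx|_ ->]; last exact: subgroup1.
have [[|m] // _ Hxm] := finite_index_power x sH fH.
apply: (@free_torsion_free x m); have : (H `&` K) (x ^+ m.+1) by split=> //; apply: subgroupX.
by rewrite HK1.
Qed.

End FreeGroupWords.

(** A Stallings graph without finiteness or connectedness: transitions are partial, and an absent
    one is what makes room for a complement. *)
Record inverse_automaton n (V : Type) := InverseAutomaton {
  edge :> V -> letter n -> V -> Prop;
  edgeV : forall p a q, edge p a q -> edge q (letterV a) p;
  edge_det : forall p a q q', edge p a q -> edge p a q' -> q = q'
}.

Section Automata.
Variables (n : nat) (V : Type) (E : inverse_automaton n V).
Implicit Types (a b : letter n) (u v w : seq (letter n)) (x y : freeGroup n).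

Fixpoint run (p : V) w (q : V) : Prop :=
  if w is a :: w' then exists2 p', E p a p' & run p' w' q else p = q.

(** If [a] cancels against the next letter, reversibility and determinism bring the path back to [p]
    after two steps, so the detour can be deleted. *)
Lemma run_push p a w q : run p (a :: w) q -> run p (push a w) q.
Proof.
case: w => [|b w] //= [p' pp' [p'' p'p'' pq]].
case: eqP p'p'' => [->|_] p'p''; first by rewrite (edge_det (edgeV pp') p'p'').
by exists p' => //; exists p''.
Qed.

Lemma run_wordM p u q v r : run p u q -> run q v r -> run p (wordM u v) r.
Proof.
elim: u p => [|a u IHu] p /=; first by move=> ->.
by case=> p' pp' p'q qr; apply: run_push; exists p' => //; apply: IHu.
Qed.

Lemma run_cat p u q v r : run p u q -> run q v r -> run p (u ++ v) r.
Proof.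
elim: u p => [|a u IHu] p /=; first by move=> ->.
by case=> p' pp' /IHu + qr => /(_ qr); exists p'.
Qed.

Lemma runV p u q : run p u q -> run q (wordV u) p.
Proof.
elim: u p => [|a u IHu] p /=; first by move=> ->.
case=> p' pp' /IHu qp'; rewrite /wordV /= rev_cons -cats1.
by apply: run_cat qp' _; exists p => //; apply: edgeV.
Qed.

Definition loops p : set (freeGroup n) := [set x | run p x p].

Lemma loops_subgroup p : subgroup (loops p).
Proof.
by apply/subgroupP; split=> // x y /= xp yp; apply: run_wordM xp (runV yp).
Qed.

End Automata.

(** * Complements *)

Section Comb.
Variables (n : nat) (a b : letter n).
Hypothesis neq_ab : a.1 != b.1.
Implicit Types (c : letter n) (u v w : seq (letter n)) (x y g : freeGroup n).

(** This is a b^(j+1) a b^-(j+1) a^-1. As the exponent of b is positive, both this word and its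
    inverse are reduced and start with a. *)
Definition comb_elt (j : nat) : freeGroup n :=
  letter_elt a ^ (letter_elt a * letter_elt b ^+ j.+1)^-1.

Definition comb (J : set nat) : set (freeGroup n) := generated (comb_elt @` J).

(* An automaton in which the only edge leaving 0 is labelled a. *)
Definition comb_arc (p : nat) c (q : nat) : Prop :=
  [\/ [/\ c = a, p = 0 & q = 1%N], [/\ c = a, (1 < p)%N & q = p]
    | [/\ c = b, (0 < p)%N & q = p.+1]].

Definition comb_edge p c q := comb_arc p c q \/ comb_arc q (letterV c) p.

Lemma comb_edgeV p c q : comb_edge p c q -> comb_edge q (letterV c) p.
Proof. by case=> pq; [right; rewrite letterVK|left]. Qed.

Lemma comb_edge_det p c q q' : comb_edge p c q -> comb_edge p c q' -> q = q'.
Proof.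
have aVa : letterV a <> a by apply/eqP/letterV_neq.
have bVb : letterV b <> b by apply/eqP/letterV_neq.
have ab : a <> b by move=> e; move: neq_ab; rewrite e eqxx.
have Vab : letterV a <> b by move=> e; move: neq_ab; rewrite -e eqxx.
have aVb : letterV b <> a by move=> e; move: neq_ab; rewrite -e eqxx.
by do 2![case=> -[] [? ? ?]]; try congruence; try lia; subst; try congruence; lia.
Qed.

Definition comb_automaton :=
  InverseAutomaton comb_edgeV comb_edge_det.

Notation runs p x q := (run comb_automaton p (word x) q).

Lemma run_combM p x q y r : runs p x q -> runs q y r -> runs p (x * y) r.
Proof. exact: run_wordM. Qed.

Lemma run_combV p x q : runs p x q -> runs q x^-1 p.
Proof. exact: runV. Qed.

(** The word a b^(j+1) leads from 0 to j + 2, which carries a loop labelled a; so each generator is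
    a loop at 0, and loops form a subgroup. *)
Lemma comb_loop J x : comb J x -> runs 0%N x 0%N.
Proof.
move: x; apply: (generated_sub (loops_subgroup comb_automaton 0%N)) => _ [j _ <-].
have go : runs 0%N (letter_elt a * letter_elt b ^+ j.+1) j.+2.
  apply: (@run_combM _ _ 1%N); first by exists 1%N => //; left; apply: Or31.
  elim: j => [|j IHj]; first by exists 2%N => //; left; apply: Or33.
  rewrite expgSr; apply: run_combM IHj _.
  by exists j.+3 => //; left; apply: Or33.
change (runs 0%N (comb_elt j) 0%N); rewrite /comb_elt conjgE invgK.
apply: (run_combM go); apply: (run_combM _ (run_combV go)).
by exists j.+2 => //; left; apply: Or32.
Qed.

Lemma comb_word J x : comb J x -> x <> 1 -> exists w, word x = a :: w.
Proof.
move=> /comb_loop; case xE: (word x) => [|c w] /=.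
  by move=> _ /(_ (word1 xE)).
case=> q cq _ _; exists w; congr cons.
by case: cq => -[] [] //; lia.
Qed.

(* [height] is the exponent sum of b and [weight j x] counts modulo 2 the     *)
(* occurrences of a^{+-1} in x that are preceded by a prefix of height j.     *)
Import GRing.Theory.
Local Open Scope ring_scope.

Definition letter_height c : int :=
  if c == b then 1 else if c == letterV b then -1 else 0.

Fixpoint word_height w : int :=
  if w is c :: w' then letter_height c + word_height w' else 0.

Fixpoint word_weight (j : int) w : 'F_2 :=
  if w is c :: w' then
    ((c.1 == a.1) && (j == 0))%:R + word_weight (j - letter_height c) w'
  else 0.

Definition height x := word_height (word x).
Definition weight j x := word_weight j (word x).

Lemma letter_heightV c : letter_height (letterV c) = - letter_height c.
Proof.
rewrite /letter_height letterV_eq (inj_eq (can_inj (@letterVK n))).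
case: (eqVneq c b) => [->|_]; first by rewrite eq_sym (negPf (letterV_neq b)).
by case: eqP => _; rewrite ?opprK ?oppr0.
Qed.

Lemma word_height_push c w : word_height (push c w) = letter_height c + word_height w.
Proof.
case: w => [|d w] //=; case: eqP => [->|//].
by rewrite letter_heightV addrA subrr add0r.
Qed.

(** A cancelling pair of letters a^{+-1} is counted twice at the same height, since these letters
    have height 0; working modulo 2 makes this harmless. *)
Lemma word_weight_push j c w : word_weight j (push c w) = word_weight j (c :: w).
Proof.
case: w => [|d w] //=; case: eqP => [->|//].
rewrite letter_heightV opprK subrK addrA [(letterV c).1]/=.
have [ca|_] := eqVneq c.1 a.1; last by rewrite !add0r.
rewrite /letter_height.
case: (eqVneq c b) ca => [-> ba|_]; first by move: neq_ab; rewrite ba eqxx.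
case: (eqVneq c (letterV b)) => [-> /= ba|_ _]; first by move: neq_ab; rewrite ba eqxx.
have F2 (e : bool) : e%:R + e%:R = 0 :> 'F_2 by case: e; apply: val_inj.
by rewrite subr0 F2 add0r.
Qed.

Lemma heightM x y : height (x * y)%g = height x + height y.
Proof.
rewrite /height /=; elim: (word x) => [|c w IHw] /=; first by rewrite add0r.
by rewrite word_height_push IHw addrA.
Qed.

(** The product rule of Fox calculus: the weights are the coefficients modulo 2 of the Fox
    derivative by a, with b sent to t and the other generators to 1. They are additive on elements
    of height 0. *)
Lemma weightM j x y : weight j (x * y)%g = weight j x + weight (j - height x) y.
Proof.
rewrite /weight /height /=.
elim: (word x) j => [|c w IHw] j /=; first by rewrite add0r subr0.
by rewrite word_weight_push /= IHw -addrA -addrA opprD.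
Qed.

Lemma heightV x : height x^-1%g = - height x.
Proof. by apply: (addrI (height x)); rewrite -heightM mulgV subrr. Qed.

Lemma weight1 j : weight j 1%g = 0. Proof. by []. Qed.

Lemma weightV j x : weight j x^-1%g = - weight (j + height x) x.
Proof.
apply: (addrI (weight (j + height x) x)); rewrite subrr.
by rewrite -{2}[j](addrK (height x)) -weightM mulgV weight1.
Qed.

Lemma height_a : height (letter_elt a) = 0.
Proof.
rewrite /height /= addr0 /letter_height.
case: eqP => [ab|_]; first by move: neq_ab; rewrite ab eqxx.
by case: eqP => // ab; move: neq_ab; rewrite ab eqxx.
Qed.

Lemma height_bX m : height (letter_elt b ^+ m)%g = m%:Z.
Proof.
elim: m => // m IHm; rewrite expgS heightM IHm.
by rewrite /height /= /letter_height eqxx addr0 intS.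
Qed.

Lemma weight_a j : weight j (letter_elt a) = (j == 0)%:R.
Proof. by rewrite /weight /= eqxx addr0. Qed.

Lemma height_comb_elt j : height (comb_elt j) = 0.
Proof.
by rewrite /comb_elt conjgE !heightM !heightV !heightM height_a !add0r opprK addrN.
Qed.

(** The outer letters a and a^-1 stand at height 0 and only the middle one at height j + 1, so the
    comb elements have the unit vectors as weights. *)
Lemma weight_comb_elt (i j : nat) : weight i.+1%:Z (comb_elt j) = (i == j)%:R.
Proof.
have hy : height (letter_elt a * letter_elt b ^+ j.+1)%g = j.+1%:Z.
  by rewrite heightM height_a add0r height_bX.
rewrite /comb_elt conjgE invgK weightM [weight _ (_ / _)%g]weightM weightV.
rewrite hy height_a subr0 subrK weight_a addrCA subrr addr0.
by rewrite subr_eq0 eqz_nat eqSS.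
Qed.

End Comb.

(** * Ranks of combs *)

Section CombRank.
Variables (n : nat) (a b : letter n).
Hypothesis neq_ab : a.1 != b.1.
Implicit Types (x y g : freeGroup n) (J : set nat).

Definition comb_basis g j := comb_elt a b j ^ g.

Lemma comb_basis_conj g J x :
  generated (comb_basis g @` J) x -> comb a b J (x ^ g^-1).
Proof.
pose C := [set y | comb a b J (y ^ g^-1)].
move: x; apply: (@generated_sub _ _ C).
  exact: subgroup_conj (generated_subgroup _).
by move=> _ [j Jj <-]; rewrite /C /= conjgK; apply: sub_generated; exists j.
Qed.

Import GRing.Theory.

Definition weight_row k g x : 'rV['F_2]_k := \row_i weight a b i.+1%:Z (x ^ g^-1).

Lemma weight_rowM k g x y : height b (x ^ g^-1) = 0%R ->
  weight_row k g (x * y) = (weight_row k g x + weight_row k g y)%R.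
Proof.
by move=> hx; apply/rowP => i; rewrite !mxE conjMg weightM // hx subr0.
Qed.

(* The weights of a generating set span the whole of F_2^k. *)
Lemma comb_rank_ge g J k (s : seq (freeGroup n)) :
  generated [set` s] = generated (comb_basis g @` J) -> `I_k `<=` J ->
  (k <= size s)%N.
Proof.
move=> sJ kJ.
pose M : 'M_(size s, k) := (\matrix_(i < size s) weight_row k g (nth 1%g s i))%R.
(* On [Z] the weight rows are additive. So the elements of [Z] whose row lies in the row space of
   [M] form a subgroup, which contains the generating set [s]. *)
pose Z := [set x | height b (x ^ g^-1) = 0%R].
have sZ : subgroup Z.
  apply/subgroupP; split=> [|x y]; rewrite /Z /= ?conj1g //.
  by move=> hx hy; rewrite conjMg conjVg heightM // heightV // hx hy subr0.
have KZ : generated (comb_basis g @` J) `<=` Z.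
  apply: generated_sub => // _ [j _ <-].
  by rewrite /Z /= conjgK height_comb_elt.
pose B := Z `&` [set x | (weight_row k g x <= M)%MS].
have sB : subgroup B.
  apply/subgroupP; split=> [|x y [Zx Bx] [Zy By]].
    split; first exact: subgroup1.
    rewrite /= (_ : weight_row k g 1 = 0%R) ?sub0mx //.
    by apply/rowP => i; rewrite !mxE conj1g.
  split; first by case/subgroupP: sZ => _; apply.
  have Zyx : Z (x * y^-1) by case/subgroupP: sZ => _; apply.
  rewrite /=; have -> : weight_row k g (x * y^-1) = (weight_row k g x - weight_row k g y)%R.
    by rewrite -[x in RHS](mulgVK y) (weight_rowM _ _ Zyx) addrK.
  by rewrite addmx_sub // eqmx_opp.
have KB : generated (comb_basis g @` J) `<=` B.
  rewrite -sJ; apply: generated_sub => // x sx; split.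
    by apply: KZ; rewrite -sJ; apply: sub_generated.
  have lt_x : (index x s < size s)%N by rewrite index_mem.
  have -> : x = nth 1 s (Ordinal lt_x) by rewrite nth_index.
  rewrite /= (_ : weight_row k g _ = row (Ordinal lt_x) M) ?row_sub //.
  by rewrite rowK.
have : ((1%:M)%R <= M)%MS.
  apply/row_subP => i; have Ji := kJ i (ltn_ord i).
  have [_] := KB (comb_basis g i) (sub_generated (imageP _ Ji)).
  rewrite /=; congr (_ <= _)%MS; apply/rowP => j.
  by rewrite !mxE conjgK weight_comb_elt // eq_sym.
move/mxrankS; rewrite mxrank1 => /leq_trans; apply; exact: rank_leq_row.
Qed.

Lemma comb_basis_inj g : injective (comb_basis g).
Proof.
move=> i j /conjg_inj /(congr1 (weight a b i.+1%:Z)).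
by rewrite !weight_comb_elt // eqxx; case: eqP.
Qed.

Lemma comb_has_rank g (T : Type) (A : set T) :
  countable A ->
  exists2 J, A #= J & has_rank (generated (comb_basis g @` J)) A.
Proof.
move=> cA.
have [J AJ JS] : exists2 J : set nat, A #= J &
    forall S : set (freeGroup n), finite_set S ->
      generated S = generated (comb_basis g @` J) -> J #<= S.
  have [[k Ak]|infA] := pselect (finite_set A).
    exists `I_k => // S [m Sm] gS; rewrite (card_le_eqr Sm) card_le_II.
    have [s sz_s sS] : exists2 s : seq (freeGroup n), (size s <= m)%N & [set` s] = S.
      have := Sm; rewrite card_eq_le => /andP[/pfcard_geP[->|[f]] _].
        by exists [::] => //; apply/seteqP; split.
      exists (map f (iota 0 m)); first by rewrite size_map size_iota.
      rewrite -[RHS](image_eq f); apply/seteqP; split=> x /=.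
        by case/mapP=> i; rewrite mem_iota => lti ->; exists i.
      by case=> i lti <-; rewrite map_f // mem_iota.
    apply: leq_trans sz_s; apply: (@comb_rank_ge g `I_k) => //.
    by rewrite sS.
  exists setT; first exact: eq_card_nat.
  move=> S /finite_seqP [s ->] gS.
  (* With all of nat as index set, a finite generating list would have to be longer than itself. *)
  by have := comb_rank_ge gS (@subsetT _ `I_(size s).+1); rewrite ltnn.
exists J => //; split=> [|S gS].
  exists (comb_basis g @` J) => //; rewrite (card_eqr AJ).
  by apply: inj_card_eq => i j _ _; apply: comb_basis_inj.
(* An infinite generating set dominates every countable cardinal. *)
have [fS|/infiniteP infS] := pselect (finite_set S).
  by rewrite (card_le_eql AJ); apply: JS.
exact: card_le_trans cA infS.
Qed.

End CombRank.

Lemma word_letterX n (a : letter n) m : word (letter_elt a ^+ m) = nseq m a.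
Proof.
elim: m => // m IHm; rewrite expgS /= IHm.
by case: m {IHm} => //= m; rewrite eq_sym (negPf (letterV_neq a)).
Qed.

(** * The free group of rank one *)

Section OneGenerator.
Variable c : letter 1.
Implicit Types (H L : set (freeGroup 1)) (x y : freeGroup 1).

Lemma free1_power x : exists m, x = letter_elt c ^+ m \/ x = letter_elt c ^- m.
Proof.
elim/free_ind: x => [|a x [m xE]]; first by exists 0%N; left.
have [->|->] : a = c \/ a = letterV c.
- case: a c => [i d] [i' d']; rewrite (ord1 i) (ord1 i').
  by case: d d' => [] []; [left|right|right|left].
- case: xE => ->; first by exists m.+1; left; rewrite expgS.
  case: m => [|m]; first by exists 1%N; left; rewrite invg1 mulg1.
  by exists m; right; rewrite expgSr invgM mulVKg.
- rewrite -letter_eltV; case: xE => ->; last first.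
    by exists m.+1; right; rewrite expgSr invgM.
  case: m => [|m]; first by exists 1%N; right; rewrite mulg1.
  by exists m; left; rewrite expgS mulKg.
Qed.

(** As for Z: Euclidean division by the least positive exponent occurring in L. *)
Lemma subgroup_free1_cyclic L : subgroup L -> exists x, generated [set x] = L.
Proof.
move=> sL; pose t := letter_elt c; have [[m0 m0P]|L0] := pselect (exists m, L (t ^+ m.+1)).
  have exm : exists m, `[< L (t ^+ m.+1) >] by exists m0; apply/asboolP.
  case: (ex_minnP exm) => m /asboolP Lm minm; exists (t ^+ m.+1).
  apply/seteqP; split; first by apply: generated_sub => // _ ->.
  have pow k : L (t ^+ k) -> generated [set t ^+ m.+1] (t ^+ k).
    move=> Lk; have Lr : L (t ^+ (k %% m.+1)).
      have -> : t ^+ (k %% m.+1) = t ^+ k * (t ^+ m.+1 ^+ (k %/ m.+1))^-1.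
        by rewrite {2}(divn_eq k m.+1) -expgnA [(m.+1 * _)%N]mulnC addnC expgnDr mulgK.
      exact: subgroupM sL Lk (subgroupV sL (subgroupX _ sL Lm)).
    have r0 : k %% m.+1 = 0.
      case kr: (k %% m.+1) => [//|r]; have := minm r; rewrite -kr => /(_ (asboolT Lr)).
      by have := ltn_pmod k (ltn0Sn m); rewrite kr; lia.
    rewrite (divn_eq k m.+1) r0 addn0 mulnC expgnA.
    by apply: (subgroupX _ (generated_subgroup _)); apply: sub_generated.
  move=> x Lx; have [k [xE|xE]] := free1_power x; first by rewrite xE; apply: pow; rewrite -xE.
  rewrite xE; apply: (subgroupV (generated_subgroup _)); apply: pow.
  by rewrite -[_ ^+ k]invgK -xE; apply: subgroupV.
exists 1; apply/seteqP; split; first by apply: generated_sub => // _ ->; apply: subgroup1.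
move=> x Lx; have [[|k] xE] := free1_power x.
  by case: xE => ->; rewrite ?invg1; apply: sub_generated.
exfalso; apply: L0; exists k; case: xE Lx => -> //.
by move=> /(subgroupV sL); rewrite invgK.
Qed.

(** Subgroups are cyclic, so a nonempty [A] that is a rank is a singleton, and the whole group has
    that rank. *)
Lemma free1_has_rank (T : Type) (A : set T) L :
  A !=set0 -> subgroup L -> has_rank L A ->
  has_rank [set: freeGroup 1] A.
Proof.
move=> [x Ax] /subgroup_free1_cyclic[d dL] [_ /(_ _ dL) A1].
have allE : generated [set letter_elt c] = setT.
  apply/seteqP; split=> // y _; have sG := generated_subgroup [set letter_elt c].
  have Gc : generated [set letter_elt c] (letter_elt c) by apply: sub_generated.
  have GX m := subgroupX m sG Gc.
  by have [m [->|->]] := free1_power y; [exact: GX | exact: subgroupV sG (GX m)].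
split=> [|S gS].
  exists [set letter_elt c] => //; rewrite card_eq_le; apply/andP; split.
    rewrite (card_le_eql (eq_card1 _ x)); apply: subset_card_le.
    by move=> _ ->.
  exact: card_le_trans A1 (proj1 (iffLR (card_eqPle _ _) (eq_card1 _ _))).
have [y Sy] : S !=set0.
  apply: (@generated_nonempty _ _ (letter_elt c)); first by rewrite gS.
  by move/(congr1 (@word 1)).
apply: card_le_trans A1 _; rewrite (card_le_eql (eq_card1 _ y)).
by apply: subset_card_le => _ ->.
Qed.

End OneGenerator.

(* A vertex v reached from p, with no edge labelled c: no loop at v has a     *)
(* word starting with c, so a conjugate of the comb, all of whose nontrivial  *)
(* words start with c, avoids the loops at p.                                 *)
Section AutomatonComplement.
Variables (n : nat) (V : Type) (E : inverse_automaton n V).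
Variables (H : set (freeGroup n)) (p v : V) (x : freeGroup n) (c : letter n).
Hypothesis sH : subgroup H.
Hypothesis loopsH : H `<=` loops E p.
Hypothesis run_pv : run E p x v.
Hypothesis no_edge : forall q, ~ E v c q.

Lemma conj_loop y : H y -> run E v (y ^ x) v.
Proof.
move=> /loopsH yp; rewrite conjgE; apply: (run_wordM (runV run_pv)).
exact: run_wordM yp run_pv.
Qed.

Lemma missing_word y w : H y -> word (y ^ x) <> c :: w.
Proof. by move=> /conj_loop + yE; rewrite yE => -[q /no_edge]. Qed.

Lemma comb_complement b J : c.1 != b.1 ->
  cap_complement H (generated (comb_basis c b x^-1 @` J)).
Proof.
move=> cb; have sK := generated_subgroup (comb_basis c b x^-1 @` J).
split=> //; apply/seteqP; split=> [y [Hy]|_ ->]; last by split; apply: subgroup1.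
move=> /comb_basis_conj; rewrite invgK => Ky.
apply/eqP; rewrite -(conjg_eq1 y x); apply/eqP; apply: contrapT => y1.
by have [w /(missing_word Hy)] := comb_word cb Ky y1.
Qed.

End AutomatonComplement.

(** With a second generator, a conjugated comb indexed by a copy of [A] is a complement; otherwise n
    = 1, H is trivial and the whole group serves. *)
Lemma automaton_complement n V (E : inverse_automaton n V)
    (H : set (freeGroup n)) p v (x : freeGroup n) c :
  subgroup H -> H `<=` loops E p -> run E p x v -> (forall q, ~ E v c q) ->
  forall (T : Type) (A : set T), A !=set0 ->
    (exists L : set (freeGroup n), subgroup L /\ has_rank L A) ->
  exists K, [/\ cap_complement H K, nontrivial K & has_rank K A].
Proof.
move=> sH loopsH run_pv no_edge T A A0 [L [sL LA]].
have [[b cb]|one] := pselect (exists b : letter n, c.1 != b.1).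
  have cA : countable A.
    have [[S _ SA] _] := LA; rewrite -(eq_countable SA); apply/countable_injP.
    by exists (pickle \o @word n) => y z _ _ /(pcan_inj pickleK) /val_inj.
  have [J AJ KA] := comb_has_rank cb x^-1 cA.
  exists (generated (comb_basis c b x^-1 @` J)); split=> //.
    exact: (comb_complement sH loopsH run_pv no_edge J cb).
  move=> K1; have [t At] := A0.
  have [j Jj] : J !=set0.
    apply/set0P/eqP => J0; move: AJ; rewrite J0 card_eq0 => /eqP AE.
    by rewrite AE in At.
  have : generated (comb_basis c b x^-1 @` J) (comb_basis c b x^-1 j).
    by apply: sub_generated; exists j.
  rewrite K1 => /eqP; rewrite /comb_basis conjg_eq1 => /eqP.
  by move=> /(congr1 (weight c b j.+1%:Z)); rewrite weight_comb_elt // eqxx.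
have n1 : n = 1%N.
  case: n c one {H sH loopsH run_pv no_edge L sL LA x E} => [[[]]//|[//|m]] c one.
  exfalso; apply: one; exists (if c.1 == ord0 then ord_max else ord0, true) => /=.
  by case: (eqVneq c.1 ord0) => [->|].
subst n.
exists setT; split; last exact: (free1_has_rank c A0 sL LA).
  split; first by apply/subgroupP.
  apply/seteqP; split=> [y [Hy _]|_ ->]; last by split=> //; exact: subgroup1.
  apply/eqP; rewrite -(conjg_eq1 y x); apply/eqP.
  (* A positive power of c would be a word starting with c. Applied to y and to its inverse, this
     makes H trivial. *)
  have pos z m : H z -> z ^ x = letter_elt c ^+ m -> z ^ x = 1.
    case: m => [//|m] Hz zE.
    have := @missing_word _ _ _ _ _ _ _ _ loopsH run_pv no_edge z (nseq m c) Hz.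
    by rewrite zE word_letterX.
  have [m [|yE]] := free1_power c (y ^ x); first exact: pos.
  apply: invg_inj; rewrite invg1 -conjVg; apply: (pos _ m); first exact: subgroupV.
  by rewrite conjVg yE invgK.
move=> T1; have : [set: freeGroup 1] (letter_elt c) by [].
by rewrite T1 => /(congr1 (@word 1)).
Qed.

(** * Labelled readings *)

Section Labelling.
Variable n : nat.
Implicit Types (a : letter n) (w : seq (letter n)) (l : seq (seq (letter n))).
Implicit Types (s : seq (freeGroup n)) (x y g : freeGroup n) (d : nat -> nat).

(** One letter is consumed per step, and the end of a word takes a step of its own, during which the
    reading stays at vertex 0. *)
Definition read_step l :=
  match l with
  | [::] => [::]
  | [::] :: l' => l'
  | (_ :: w) :: l' => w :: l'
  end.

Definition read s t := iter t read_step (map (@word n) s).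

Definition read_letter s t : option (letter n) := ohead (head [::] (read s t)).

Definition label_arc s N d (p : nat) a (q : nat) :=
  exists t, [/\ (t <= N)%N, read_letter s t = Some a, d t = p & d t.+1 = q].

Definition label_edge s N d p a q :=
  label_arc s N d p a q \/ label_arc s N d q (letterV a) p.

(* [d t] is the vertex reached at time t, in an incomplete inverse automaton  *)
(* where all the words of [s] are loops at 0.                                 *)
Record labelling s N d : Prop := Labelling {
  label0 : d 0%N = 0%N;
  label_end : forall t, (t <= N)%N -> read_letter s t = None ->
    d t = 0%N /\ d t.+1 = 0%N;
  label_det : forall p a q q',
    label_edge s N d p a q -> label_edge s N d p a q' -> q = q';
  label_missing : exists t a, (t <= N.+1)%N /\
    forall q, ~ label_edge s N d (d t) a q
}.

Lemma label_edgeV s N d p a q :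
  label_edge s N d p a q -> label_edge s N d q (letterV a) p.
Proof. by case=> ?; [right; rewrite letterVK | left]. Qed.

Lemma labelling_automaton s N d : read s N = [::] -> labelling s N d ->
  exists (E : inverse_automaton n nat) x c v,
    [/\ [set` s] `<=` loops E 0%N, run E 0%N x v & forall q, ~ E v c q].
Proof.
move=> sN [d0 d_end det [t0 [c [t0N no_edge]]]].
pose E := InverseAutomaton (@label_edgeV s N d) det.
have [x run_x] : exists x : freeGroup n, run E 0%N x (d t0).
  elim: t0 t0N {no_edge} => [_|t IHt tN]; first by exists 1; rewrite d0.
  have [x run_x] := IHt (ltnW tN).
  case tE: (read_letter s t) => [a|]; last first.
    by have [_ ->] := d_end _ tN tE; exists 1.
  exists (x * letter_elt a); apply: (run_wordM run_x).
  by exists (d t.+1) => //; left; exists t.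
exists E, x, c, (d t0); split=> //.
(* Backward induction from time N, when nothing is left to read: the rest of the current word leads
   from [d t] to 0, and the later words are loops at 0. *)
pose loop_from t := match read s t with
  | [::] => True
  | w :: l => run E (d t) w 0%N /\ forall w', w' \in l -> run E 0%N w' 0%N
  end.
have loopP k : (k <= N)%N -> loop_from (N - k)%N.
  elim: k => [|k IHk] kN; first by rewrite /loop_from subn0 sN.
  have := IHk (ltnW kN); have -> : (N - k = (N - k.+1).+1)%N by lia.
  have tN : (N - k.+1 <= N)%N by lia.
  move: (N - k.+1)%N tN => t tN; rewrite /loop_from /read iterS -/(read s t).
  have := d_end _ tN; have arcP a : read_letter s t = Some a -> E (d t) a (d t.+1).
    by move=> tE; left; exists t.
  move: arcP; rewrite /read_letter; case: (read s t) => [|[|a w] l] //= arcP.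
    move=> /(_ erefl) [-> ->] lP; split=> // w' w'l.
    by case: l lP w'l => // w l [? lP]; rewrite inE => /predU1P[->|/lP].
  by move=> _ [run_w lP]; split=> //; exists (d t.+1) => //; apply: arcP.
have := loopP N (leqnn N); rewrite subnn /loop_from /read /= => {}loopP y ys.
rewrite /loops /=; have : word y \in map (@word n) s by apply: map_f.
case: (map _ s) loopP => // w l; rewrite d0 => -[run_w lP].
by rewrite inE => /predU1P[->|/lP].
Qed.

(** Vertices are the cosets visited while reading, each named by its first visit; infinitely many
    cosets force a missing edge. *)
Lemma infinite_index_labelling s N : infinite_index (generated [set` s]) ->
  exists2 d, (forall t, d t <= t)%N & labelling s N d.
Proof.
set H := generated _ => infH; have sH : subgroup H := generated_subgroup _.
(* The prefix of the current word read so far, reset to 1 when a word ends. *)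
pose pos := fix pos t : freeGroup n :=
  if t is t'.+1 then
    if read_letter s t' is Some a then pos t' * letter_elt a else 1
  else 1.
(* The inverse is taken because cosets are left cosets: reading a letter a then acts on them by left
   multiplication by a^-1. *)
pose vtx t := left_coset H (pos t)^-1.
have vtx_eq t t' : H (pos t * (pos t')^-1) -> vtx t = vtx t'.
  by move=> Htt'; apply/(left_coset_eq _ _ sH); rewrite invgK.
(* Invariant: the prefix read times the rest of the current word is a generator or 1, hence in H, so
   [pos t] is in H at the end of each word. *)
have posP t : if read s t is w :: l then
    (exists2 y, word y = w & H (pos t * y)) /\
    (forall w', w' \in l -> exists2 y, word y = w' & H y)
  else H (pos t).
  elim: t => [|t]; last first.
    rewrite /read iterS -/(read s t) /= /read_letter.
    case: (read s t) => [|[|a w] l] /=.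
    - by move=> _; apply: subgroup1.
    - case=> _ lP; case: l lP => [|w l] lP; first exact: subgroup1.
      split=> [|w' w'l]; last by apply: lP; rewrite inE w'l orbT.
      by have [|y yw Hy] := lP w; [rewrite inE eqxx | exists y; rewrite ?mul1g].
    - case=> -[y yw Hy] lP; split=> //.
      have [y' yE y'w] := word_cons yw; exists y' => //.
      by rewrite -mulgA -yE.
  rewrite /read /=; have sP w : w \in map (@word n) s -> exists2 y, word y = w & H y.
    by case/mapP=> y ys ->; exists y => //; apply: sub_generated.
  case: (map _ s) sP => [_|w l sP]; first exact: subgroup1.
  split=> [|w' w'l]; last by apply: sP; rewrite inE w'l orbT.
  by have [|y yw Hy] := sP w; [rewrite inE eqxx | exists y; rewrite ?mul1g].
have first_time t : exists t', `[< vtx t' = vtx t >] by exists t; apply/asboolP.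
pose d t := ex_minn (first_time t).
have vtx_d t : vtx (d t) = vtx t by rewrite /d; case: ex_minnP => t' /asboolP.
have d_min t t' : vtx t' = vtx t -> (d t <= t')%N.
  by move=> tt'; rewrite /d; case: ex_minnP => m _; apply; apply/asboolP.
have d_eq t t' : vtx t = vtx t' -> d t = d t'.
  by move=> tt'; apply/eqP; rewrite eqn_leq !d_min ?vtx_d.
have d_id t : d (d t) = d t by apply: d_eq.
pose act g C : set (freeGroup n) := [set g * x | x in C].
have act_coset g x : act g (left_coset H x) = left_coset H (g * x).
  by rewrite /act /left_coset image_comp; apply: eq_imagel => y _ /=; rewrite mulgA.
have actK g C : act g (act g^-1 C) = C.
  apply/seteqP; split=> [_ [_ [x Cx <-] <-]|x Cx]; first by rewrite mulVKg.
  by exists (g^-1 * x); [exists x | rewrite mulVKg].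
have arcP p a q : label_arc s N d p a q ->
    [/\ d p = p, d q = q & vtx q = act (letter_elt a)^-1 (vtx p)].
  case=> t [_ tE <- <-]; rewrite !d_id !vtx_d; split=> //.
  by rewrite /vtx act_coset /= tE invgM.
have edgeP p a q : label_edge s N d p a q ->
    [/\ d q = q & vtx q = act (letter_elt a)^-1 (vtx p)].
  case=> /arcP[dp dq]; first by [].
  rewrite -letter_eltV invgK => ->; split=> //.
  by have := actK (letter_elt a)^-1 (vtx q); rewrite invgK.
exists d; first by move=> t; apply: d_min.
split.
- by have := d_min 0%N 0%N erefl; case: (d 0%N).
- move=> t _ tE; have Ht : H (pos t).
    have := posP t; move: tE; rewrite /read_letter; case: (read s t) => [|[|//] l] //= _.
    by case=> -[y /word1 ->]; rewrite mulg1.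
  have d0 t' : H (pos t') -> d t' = 0%N.
    move=> Ht'; apply/eqP; rewrite -leqn0; apply: d_min; apply: vtx_eq.
    by rewrite mul1g; exact: subgroupV sH Ht'.
  by split; apply: d0 => //=; rewrite tE; apply: subgroup1.
- move=> p a q q' /edgeP[dq pq] /edgeP[dq' pq'].
  by rewrite -dq -dq'; apply: d_eq; rewrite pq pq'.
(* If no edge were missing, the finite set of cosets visited up to time N + 1 would be stable under
   all letters, hence contain every coset. *)
pose V0 := vtx @` `I_N.+2.
have fV0 : finite_set V0 by apply: finite_image.
apply: contrapT => full; apply: infH; apply: sub_finite_set fV0.
have closed a C : V0 C -> V0 (act (letter_elt a)^-1 C).
  case=> t tN <-; apply: contrapT => nV0; apply: full; exists t, a; split=> // q /[dup].
  move=> /edgeP [_ qE] pq; apply: nV0; rewrite vtx_d in qE; rewrite -qE.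
  case: pq => -[t' [t'N _ dt' dt'1]]; [exists t'.+1|exists t']; rewrite /= ?ltnS //.
  - by rewrite -dt'1 vtx_d.
  - exact: leqW.
  - by rewrite -dt' vtx_d.
move=> _ [x ->]; change (V0 (left_coset H x)).
elim/free_ind: x => [|a x IHx]; first by exists 0%N => //; rewrite /vtx /= invg1.
by rewrite -act_coset -[letter_elt a]invgK letter_eltV; apply: closed.
Qed.

Lemma labelling_complement s N d : read s N = [::] -> labelling s N d ->
  forall (T : Type) (A : set T), A !=set0 ->
    (exists L : set (freeGroup n), subgroup L /\ has_rank L A) ->
  exists K, [/\ cap_complement (generated [set` s]) K, nontrivial K & has_rank K A].
Proof.
move=> sN /(labelling_automaton sN)[E [x [c [v [loops_s run_x no_edge]]]]].
apply: (automaton_complement (generated_subgroup _) _ run_x no_edge).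
exact: generated_sub (loops_subgroup E _) loops_s.
Qed.

End Labelling.

(* Arithmetisation of labellings *)
Local Close Scope group_scope.

Section CodedWords.
Variable n : nat.
Implicit Types (a : letter n) (l : seq (seq (letter n))) (s : seq (freeGroup n)).

Lemma code_letter_inj : injective (@code_letter n).
Proof.
move=> [i b] [j c]; rewrite /code_letter /= => e.
have bc : b = c.
  by move/(congr1 odd): (e); rewrite !oddD !odd_double /=; case: b c {e} => [] [].
by congr pair => //; apply: val_inj; move: e; rewrite bc /= => /addIn/double_inj.
Qed.

Lemma code_letter_lt a : code_letter a < 2 * n.
Proof. by case: a => i b; rewrite /code_letter /=; have := ltn_ord i; case: b; lia. Qed.

Lemma code_letter_surj x : x < 2 * n -> exists a, code_letter a = x.
Proof.
move=> xn; have x2 : x./2 < n by have := odd_double_half x; lia.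
by exists (Ordinal x2, odd x); rewrite /code_letter /= addnC odd_double_half.
Qed.

Lemma inv_codeE a : inv_code (code_letter a) = code_letter (letterV a).
Proof.
case: a => i b; rewrite /inv_code /code_letter /= modn2 oddD odd_double /=.
by case: b => /=; lia.
Qed.

Definition code_list l := CodeSeq.code (map (CodeSeq.code \o map (@code_letter n)) l).

Lemma code_words_list s : code_words s = code_list (map (@word n) s).
Proof. by rewrite /code_words /code_list -map_comp. Qed.

Lemma code_cons_gt0 i t : 0 < CodeSeq.code (i :: t).
Proof. by rewrite /= muln_gt0 expn_gt0. Qed.

Lemma code_head_list l :
  code_head (code_list l) = CodeSeq.code (map (@code_letter n) (head [::] l)).
Proof. by case: l => //= w l; rewrite code_headE. Qed.

Lemma code_step_list l : code_step (code_list l) = code_list (read_step l).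
Proof.
rewrite /code_step code_head_list; case: l => [|[|a w] l] //.
  by rewrite [head _ _]/= [CodeSeq.code _ == 0]/= eqxx code_tailE.
rewrite ifN; last by rewrite -lt0n; apply: code_cons_gt0.
by rewrite [RHS]code_consE; congr code_cons; apply: code_tailE.
Qed.

Lemma code_readE s t : code_read (code_words s) t = code_list (read s t).
Proof.
rewrite /code_read /read code_words_list.
by elim: t => //= t ->; apply: code_step_list.
Qed.

Lemma code_list_step_lt l : l <> [::] -> code_list (read_step l) < code_list l.
Proof.
case: l => // -[|a w] l _.
  by rewrite /code_list /= mul1n; lia.
rewrite /code_list /= ltn_mul2r /= ltn_exp2l //.
by apply: leq_trans (leq_pmull _ (expn_gt0 2 (code_letter a))); lia.
Qed.

(** Each step strictly lowers the code of a nonempty remaining list, so the code of the input bounds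
    the reading time. *)
Lemma read_end s : read s (code_words s) = [::].
Proof.
have lt_code t : code_list (read s t) <= code_words s - t.
  elim: t => [|t IHt]; first by rewrite subn0 code_words_list.
  rewrite /read iterS -/(read s t).
  have [->|/eqP ne] := eqVneq (read s t) [::]; first by [].
  by have := code_list_step_lt ne; lia.
have := lt_code (code_words s); rewrite subnn leqn0.
by case: (read _ _) => // w l; rewrite eqn0Ngt code_cons_gt0.
Qed.

Lemma read_letter_None s t :
  (code_head (code_read (code_words s) t) == 0) = (read_letter s t == None).
Proof.
rewrite code_readE code_head_list /read_letter.
by case: (head _ _) => // a w; rewrite eqn0Ngt code_cons_gt0.
Qed.

Lemma read_letter_Some s t a :
  ~~ (code_head (code_read (code_words s) t) == 0) &&
  (code_head (code_head (code_read (code_words s) t)) == code_letter a) =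
  (read_letter s t == Some a).
Proof.
rewrite read_letter_None code_readE code_head_list /read_letter.
case: (head _ _) => // b w; rewrite [ohead _]/= code_headE.
by rewrite (inj_eq code_letter_inj) [RHS](inj_eq Some_inj).
Qed.

Variables (s : seq (freeGroup n)) (M c : nat).
Let N := code_words s.
Let d := digit M c.

Lemma arc_codeP p a q :
  label_arc s N d p a q <-> arc_code N M c p (code_letter a) q.
Proof.
split=> [[t [tN ta dp dq]]|/hasP[t]].
  apply/hasP; exists t; first by rewrite mem_iota.
  by rewrite andbA read_letter_Some ta -/d dp dq !eqxx.
rewrite mem_iota andbA read_letter_Some => /andP[_ tN] /and3P[/eqP ta /eqP dp /eqP dq].
by exists t.
Qed.

Lemma edge_codeP p a q :
  label_edge s N d p a q <-> edge_code N M c p (code_letter a) q.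
Proof.
rewrite /edge_code inv_codeE; split=> [[] /arc_codeP ->|/orP[] /arc_codeP]; rewrite ?orbT //.
  by left.
by right.
Qed.

Hypothesis M0 : 0 < M.

Lemma digit_lt t : d t < M.
Proof. by rewrite /d /digit ltn_mod. Qed.

Lemma label_edge_lt p a q : label_edge s N d p a q -> p < M /\ q < M.
Proof. by case=> -[t [_ _ <- <-]]; split; apply: digit_lt. Qed.

(** The bounded quantifiers lose nothing: endpoints of edges are digits, hence below M, and letters
    are exactly the codes below 2n. *)
Lemma labelling_codeP : labelling s N d <-> labelling_code (2 * n) N M c.
Proof.
split=> [[d0 d_end det [t [a [tN no_edge]]]]|/and4P[/eqP d0 /allP d_end det missing]].
  apply/and4P; split.
  - exact/eqP.
  - apply/allP => t'; rewrite mem_iota => tN'; apply/implyP; rewrite read_letter_None.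
    by move=> /eqP /(d_end _ tN') [] /eqP -> /eqP.
  - apply/allP => p _; apply/allP => x; rewrite mem_iota => /code_letter_surj[b <-].
    apply/allP => q _; apply/allP => q' _; apply/implyP => /andP[].
    by move=> /edge_codeP pq /edge_codeP pq'; apply/eqP; apply: det pq pq'.
  - apply/hasP; exists t; first by rewrite mem_iota.
    apply/hasP; exists (code_letter a); first by rewrite mem_iota code_letter_lt.
    apply/allP => q _; apply/negP => /edge_codeP; apply: no_edge.
split=> //.
- move=> t tN ta; have := d_end t; rewrite mem_iota read_letter_None ta eqxx.
  by move=> /(_ tN) /andP[/eqP ? /eqP].
- move=> p a q q' pq pq'.
  have [pM qM] := label_edge_lt pq; have [_ q'M] := label_edge_lt pq'.
  move/allP: det => /(_ p); rewrite mem_iota => /(_ pM).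
  move=> /allP /(_ (code_letter a)); rewrite mem_iota => /(_ (code_letter_lt a)).
  move=> /allP /(_ q); rewrite mem_iota => /(_ qM).
  move=> /allP /(_ q'); rewrite mem_iota => /(_ q'M).
  by move=> /implyP H; apply/eqP/H; apply/andP; split; apply/edge_codeP.
- move/hasP: missing => [t]; rewrite mem_iota => tN /hasP[x].
  rewrite mem_iota => /code_letter_surj[a <-] /allP no_edge.
  exists t, a; split=> // q pq; have [_ qM] := label_edge_lt pq.
  have := no_edge q; rewrite mem_iota => /(_ qM) /negP; apply.
  exact/edge_codeP.
Qed.

End CodedWords.

(** Only the labels up to time N + 1 matter, so a labelling may be replaced by the digits of a
    number. *)
Lemma labelling_ext n (s : seq (freeGroup n)) N d d' :
  (forall t, t < N.+2 -> d t = d' t) -> labelling s N d -> labelling s N d'.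
Proof.
move=> dd' [d0 d_end det [t0 [a0 [t0N no_edge]]]].
have arcE p a q : label_arc s N d' p a q -> label_arc s N d p a q.
  by case=> t [tN ta dp dq]; exists t; rewrite !dd' // ltnS ltnW.
have edgeE p a q : label_edge s N d' p a q -> label_edge s N d p a q.
  by case=> /arcE; [left | right].
split.
- by rewrite -dd'.
- by move=> t tN ta; rewrite -!dd' ?ltnS // 1?ltnW //; apply: d_end.
- by move=> p a q q' /edgeE pq /edgeE; apply: det.
- by exists t0, a0; split=> // q; rewrite -dd' // => /edgeE; apply: no_edge.
Qed.

Theorem proposition6p2 (n : nat) (hn : (1 <= n)%N) :
  (forall H : set (freeGroup n), subgroup H -> finitely_generated H ->
     ((exists K : set (freeGroup n), cap_complement H K /\ nontrivial K) ->
        infinite_index H) /\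
     (infinite_index H ->
        forall (T : Type) (A : set T), A !=set0 ->
          (exists L : set (freeGroup n), subgroup L /\ has_rank L A) ->
          exists K : set (freeGroup n),
            [/\ cap_complement H K, nontrivial K & has_rank K A])) /\
  recursively_decidable (@code_words n)
    (fun s : seq (freeGroup n) =>
       exists K : set (freeGroup n),
         cap_complement (generated [set` s]) K /\ nontrivial K).
Proof.
split=> [H _ [S /finite_seqP[s ->] <-]|].
  split=> [[K [HK nK]]|infH].
    exact: (cap_complement_infinite_index (generated_subgroup _) HK nK).
  have [d _ dP] := infinite_index_labelling (code_words s) infH.
  exact: (labelling_complement (read_end s) dP).
have [f fP] := recursive_labelled_code (2 * n) 1.
exists f => s; have := fP [tuple code_words s]; rewrite /=.
have -> : labelled_code (2 * n) (code_words s) =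
    `[< exists K, cap_complement (generated [set` s]) K /\ nontrivial K >].
  apply/idP/asboolP => [/hasP[c _ /labelling_codeP dP]|[K [HK nK]]].
    (* The rank is taken to be 1, which is attained by the cyclic subgroup of a generator; one
       exists since n is positive. *)
    have [||K [HK nK _]] := labelling_complement (read_end s) (dP isT) (A := [set tt]).
    - by exists tt.
    - exists (generated [set generator (Ordinal hn)]); split; first exact: generated_subgroup.
      by apply: has_rank_cycle => /(congr1 (@word n)).
    - by exists K.
  have infH : infinite_index (generated [set` s]).
    exact: (cap_complement_infinite_index (generated_subgroup _) HK nK).
  have [d d_le dP] := infinite_index_labelling (code_words s) infH.
  (* Since [d t <= t], the labels up to time N + 1 are digits in base N + 2, within the range of the
     search. *)
  have [t tN|c cM cd] := @digits_ex (code_words s).+2 d (code_words s).+2.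
    exact: leq_ltn_trans (d_le t) tN.
  apply/hasP; exists c; first by rewrite mem_iota.
  by apply/labelling_codeP => //; apply: labelling_ext dP => t /cd.
by move=> fE; split=> [/asboolT|/asboolF] E; rewrite E in fE.
Qed.
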